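(* Let $q$ be a prime power, $F_q$ the field with $q$ elements, $V=F_q^n$, and $1<k<n-1$. Let $S$ be a $(k-1)$-dimensional linear code in $V$ whose generator matrix $M$ has exactly one zero column, and let $S'\subseteq F_q^{n-1}$ be the code generated by the $(k-1)\times(n-1)$ matrix $M'$ obtained from $M$ by deleting the zero column. If $S'$ is a $(k-1)$-dimensional projective code, then $[S\rangle^{\Pi}_{k}$ is a star of $\Pi[n,k]_q$.
   Context: A linear code $[n,k]_q$ is a $k$-dimensional subspace of $V=F_q^n$; a generator matrix is a matrix whose rows form a basis of it. A code is projective if the columns of a generator matrix are non-zero and pairwise non-proportional. $\Pi(n,k)_q$ denotes the set of all $k$-dimensional projective codes in $V$, and $\Pi[n,k]_q$ is the simple graph with vertex set $\Pi(n,k)_q$ in which two distinct codes are adjacent iff their intersection is $(k-1)$-dimensional. A clique is a set of pairwise adjacent vertices; it is maximal if not properly contained in another clique. $[S\rangle^{\Pi}_{k}$ denotes the set of all elements of $\Pi(n,k)_q$ containing $S$; it is called a star of $\Pi[n,k]_q$ if it is a maximal clique of $\Pi[n,k]_q$. *)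

(* Defs.v *)
From mathcomp Require Import all_boot all_order all_algebra.
From mathcomp Require Import classical_sets.

Set Implicit Arguments.
Unset Strict Implicit.
Unset Printing Implicit Defensive.

Import GRing.Theory.

Local Open Scope classical_set_scope.
Local Open Scope ring_scope.

Section Graphs.
Variables (T : Type) (vert : set T) (adj : T -> T -> Prop).

Definition is_clique (X : set T) : Prop :=
  X `<=` vert /\ forall x y, X x -> X y -> x <> y -> adj x y.

Definition is_max_clique (X : set T) : Prop :=
  is_clique X /\ forall Y, is_clique Y -> ~ X `<` Y.

End Graphs.

Section Codes.
Variables (F : finFieldType) (n : nat).
Implicit Types (C S U W : {vspace 'rV[F]_n}) (k : nat).

Definition generator_matrix k C (M : 'M[F]_(k, n)) : bool :=
  basis_of C [seq row i M | i <- enum 'I_k].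

Definition proportional k (u v : 'cV[F]_k) : Prop :=
  exists2 a : F, a != 0 & u = a *: v.

Definition projective_mx k (M : 'M[F]_(k, n)) : Prop :=
  (forall j, col j M != 0) /\
  (forall i j, i != j -> ~ proportional (col i M) (col j M)).

(* The choice of the generator matrix is irrelevant: see projectiveP. *)
Definition projective C : Prop :=
  exists M : 'M[F]_(\dim C, n), generator_matrix C M /\ projective_mx M.

Lemma generator_matrix_dim k C (M : 'M[F]_(k, n)) :
  generator_matrix C M -> \dim C = k.
Proof.
move=> hM; rewrite -(span_basis hM) (eqnP (basis_free hM)).
by rewrite size_map size_enum_ord.
Qed.

Lemma projective_mx_gen k l C (M : 'M[F]_(k, n)) (N : 'M[F]_(l, n)) :
  generator_matrix C M -> generator_matrix C N ->
  projective_mx M -> projective_mx N.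
Proof.
move=> hM hN.
have rowM i : row i M \in <<[seq row i N | i <- enum 'I_l]>>%VS.
  rewrite (span_basis hN); apply: (basis_mem hM).
  by apply/mapP; exists i; rewrite ?mem_enum.
have [A ->] : exists A, M = A *m N.
  apply/submxP/row_subP => i; have /coord_span -> := rowM i.
  apply: summx_sub => j _; rewrite scalemx_sub //=.
  have /mapP[j' _ ->] : [seq row i N | i <- enum 'I_l]`_j
      \in [seq row i N | i <- enum 'I_l].
    by rewrite mem_nth // size_map -cardE.
  exact: row_sub.
have colA j : col j (A *m N) = A *m col j N by rewrite !colE mulmxA.
case=> nz np; split=> [j | i j /np npij [a a0 eij]].
  by apply: contraNneq (nz j); rewrite colA => ->; rewrite mulmx0.
by apply: npij; exists a; rewrite // !colA eij scalemxAr.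
Qed.

Lemma projectiveP k C (M : 'M[F]_(k, n)) :
  generator_matrix C M -> (projective C <-> projective_mx M).
Proof.
move=> hM; split=> [[N [hN]] | pM]; first exact: projective_mx_gen hN hM.
have dC := generator_matrix_dim hM; case: k / dC M hM pM => M hM pM.
by exists M.
Qed.

Definition projective_codes k : set {vspace 'rV[F]_n} :=
  [set C | \dim C = k /\ projective C].

Definition code_adj k U W : Prop := U <> W /\ \dim (U :&: W)%VS = k.-1.

Definition projective_codes_above k S : set {vspace 'rV[F]_n} :=
  [set C | projective_codes k C /\ (S <= C)%VS].

Definition is_star k S : Prop :=
  is_max_clique (projective_codes k) (code_adj k) (projective_codes_above k S).

End Codes.

Definition row_span (F : finFieldType) (m n : nat) (M : 'M[F]_(m, n)) :
  {vspace 'rV[F]_n} := <<[seq row i M | i <- enum 'I_m]>>%VS.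

(* Main.v *)
(** Since every column of [M] except the [i0]-th is nonzero and these are
    pairwise non-proportional, a code [C] of dimension [k] containing [S] is
    projective as soon as it contains a vector whose [i0]-th coordinate is
    nonzero.  Distinct codes of this kind meet exactly in [S], so they form a
    clique.  If [W] is adjacent to all of them without containing [S], then
    [dim (S + W) <= k + 1 < n], because [S + W] lies in [C + W] for any such [C].
    The vectors with nonzero [i0]-th coordinate span the whole space, hence one
    of them, [v], lies outside [S + W].  The projective code [S + <v>] then meets
    [S + W] only in [S], so its [(k - 1)]-dimensional intersection with [W] is
    [S], contradicting that [W] does not contain [S]. *)

Require Import Defs.
From mathcomp Require Import all_boot all_order all_algebra.
From mathcomp Require Import classical_sets.

Import GRing.Theory.
Local Open Scope ring_scope.

(** Each codeword is a combination of the rows of [M], so a zero column, or a proportionality of two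
    columns, would pass to the same coordinates of all codewords. Single codewords thus suffice as
    witnesses. *)
Lemma projective_coord (F : finFieldType) (n : nat) (C : {vspace 'rV[F]_n}) :
  (forall j, exists2 x, x \in C & x 0 j != 0) ->
  (forall i j a, i != j -> a != 0 -> exists2 x, x \in C & x 0 i != a * x 0 j) ->
  projective C.
Proof.
move=> nz np; pose M := \matrix_(i < \dim C) (vbasis C)`_i.
have coordC x (j : 'I_n) : x \in C ->
    x 0 j = \sum_(r < \dim C) coord (vbasis C) r x * M r j.
  move=> /coord_vbasis {1}->; rewrite summxE; apply: eq_bigr => r _.
  by rewrite !mxE.
exists M; split.
  rewrite /generator_matrix; suff -> : [seq row i M | i <- enum 'I_(\dim C)] =
    vbasis C by exact: vbasisP.
  apply: (@eq_from_nth _ 0); first by rewrite size_map size_enum_ord size_tuple.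
  move=> i; rewrite size_map size_enum_ord => lti.
  by rewrite (nth_map (Ordinal lti)) ?size_enum_ord // rowK nth_enum_ord.
split=> [j | i j nij [a a0 /colP eij]].
  have [x xC] := nz j; apply: contraNneq => /colP Mj; rewrite coordC //.
  by rewrite big1 // => r _; have := Mj r; rewrite !mxE => ->; rewrite mulr0.
have [x xC /eqP[]] := np i j a nij a0; rewrite !coordC // mulr_sumr.
apply: eq_bigr => r _; rewrite mulrCA; congr (_ * _).
by have := eij r; rewrite !mxE.
Qed.

Lemma generator_matrix_row_span (F : finFieldType) (m n : nat)
    (M : 'M[F]_(m, n)) :
  \dim (row_span M) = m -> generator_matrix (row_span M) M.
Proof.
move=> dM; rewrite /generator_matrix basisEdim size_map size_enum_ord.
by rewrite dM leqnn subvv.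
Qed.

Lemma row_generator_matrix (F : finFieldType) (m n : nat)
    (C : {vspace 'rV[F]_n}) (M : 'M[F]_(m, n)) (r : 'I_m) :
  generator_matrix C M -> row r M \in C.
Proof. by move/basis_mem; apply; apply/map_f; rewrite mem_enum. Qed.

Lemma projective_above {F : finFieldType} {n m : nat} {S C : {vspace 'rV[F]_n}}
    {M : 'M[F]_(m, n)} {i0 : 'I_n} {v : 'rV[F]_n} :
  generator_matrix S M -> col i0 M = 0 -> projective_mx (col' i0 M) ->
  (S <= C)%VS -> v \in C -> v 0 i0 != 0 -> projective C.
Proof.
move=> hM M0 [nz np] SC vC v0.
have rowC r : row r M \in C.
  by apply: (subvP SC); apply: row_generator_matrix hM.
have M0r r : M r i0 = 0 by move/colP: M0 => /(_ r); rewrite !mxE.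
have nzM j : exists r, M r (lift i0 j) != 0.
  by have /cV0Pn[r] := nz j; rewrite !mxE; exists r.
apply: projective_coord => [j | i j a].
  case: (unliftP i0 j) => [j' | ] ->; last by exists v.
  by have [r Mr] := nzM j'; exists (row r M); rewrite ?mxE.
(* If one of the two coordinates is [i0], a row of [M] nonzero at the other separates them, being
   zero at [i0]. *)
case: (unliftP i0 i) => [i' | ] ->; case: (unliftP i0 j) => [j' | ] -> nij a0.
- have nij' : i' != j' by apply: contraNneq nij => ->.
  have : col i' (col' i0 M) - a *: col j' (col' i0 M) != 0.
    by rewrite subr_eq0; apply/eqP => eij; apply: np nij' _; exists a.
  case/cV0Pn=> r; rewrite !mxE subr_eq0 => Mr.
  by exists (row r M); rewrite ?mxE.
- have [r Mr] := nzM i'; exists (row r M) => //.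
  by rewrite !mxE M0r mulr0.
- have [r Mr] := nzM j'; exists (row r M) => //.
  by rewrite !mxE M0r eq_sym mulf_neq0.
- by rewrite eqxx in nij.
Qed.

(** If [x] lies outside [U] but vanishes at [i], the unit vector [e] repairs it: either [e] is
    outside [U], or [x + e] is. *)
Lemma exists_notin_coord_neq0 {F : finFieldType} {n : nat}
    {U : {vspace 'rV[F]_n}} (i : 'I_n) :
  (\dim U < n)%N -> exists2 v : 'rV[F]_n, v \notin U & v 0 i != 0.
Proof.
move=> ltU; have [x xU] : exists x : 'rV[F]_n, x \notin U.
  have /subvPn[x _ xU] : ~~ ({:'rV[F]_n} <= U)%VS.
    by apply: contraL ltU => /dimvS; rewrite dimvf dim_matrix mul1r -leqNgt.
  by exists x.
have [xi | ?] := eqVneq (x 0 i) 0; last by exists x.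
pose e : 'rV[F]_n := delta_mx 0 i.
have [eU | eU] := boolP (e \in U); last by exists e; rewrite // mxE !eqxx oner_eq0.
by exists (x + e); rewrite ?rpredDr // !mxE xi add0r !eqxx oner_eq0.
Qed.

Lemma dim_add_line (F : fieldType) (vT : vectType F) (U : {vspace vT}) (v : vT) :
  v \notin U -> \dim (U + <[v]>)%VS = (\dim U).+1.
Proof.
move=> vU; have v0 : v != 0 by apply: contraNneq vU => ->; rewrite mem0v.
rewrite dimv_disjoint_sum ?dim_vline ?v0 ?addn1 //; apply/eqP.
rewrite -subv0; apply/subvP => u /memv_capP[uU /vlineP[a eu]].
move: uU; rewrite {}eu rpredZeq (negPf vU) orbF => /eqP ->.
by rewrite scale0r mem0v.
Qed.

Theorem theorem2 (F : finFieldType) (n k : nat) (hk1 : (1 < k)%N)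
    (hkn : (k < n.-1)%N) (S : {vspace 'rV[F]_n}) (hS : \dim S = k.-1)
    (M : 'M[F]_(k.-1, n)) (hM : generator_matrix S M)
    (i0 : 'I_n) (hi0 : forall j : 'I_n, col j M = 0 <-> j = i0)
    (hS' : projective_codes k.-1 (row_span (col' i0 M))) :
  is_star k S.
Proof.
have M0 : col i0 M = 0 by apply/hi0.
(* The row span has dimension [k.-1], so [col' i0 M] is itself a generator matrix of it. *)
have pM : projective_mx (col' i0 M).
  by case: hS' => /generator_matrix_row_span/projectiveP[+ _]; apply.
have kE : k.-1.+1 = k by apply: ltn_predK hk1.
have aboveS v : v \notin S -> v 0 i0 != 0 ->
    projective_codes_above k S (S + <[v]>)%VS.
  move=> vS v0; split; last exact: addvSl.
  split; first by rewrite dim_add_line // hS.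
  by apply: (projective_above (v := v) hM M0 pM) => //;
     rewrite ?addvSl // memvE addvSr.
have capE C D : \dim C = k -> \dim D = k -> C <> D -> (\dim (C :&: D) <= k.-1)%N.
  move=> dC dD nCD; rewrite -ltnS kE ltn_neqAle -{2}dC dimvS ?capvSl // andbT.
  apply/eqP => dCD; apply: nCD.
  have /eqP <- : (C :&: D == C)%VS by rewrite eqEdim capvSl dCD dC leqnn.
  by apply/eqP; rewrite eqEdim capvSr dCD dD leqnn.
split; first split=> [C [] // | C D [[dC _] SC] [[dD _] SD] nCD].
  split=> //; apply/eqP; rewrite eqn_leq capE //=.
  by rewrite -hS dimvS // subv_cap SC SD.
(* Maximality reduces to showing that every [W] in [Y] contains [S]. *)
move=> Y [Yvert Yadj] [XY nYX]; apply: nYX => W WY.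
have [dW pW] := Yvert _ WY; split=> //.
have [// | nSW] := boolP (S <= W)%VS.
have capW C : projective_codes_above k S C -> \dim (C :&: W)%VS = k.-1.
  move=> CX; have nCW : C <> W by case: CX => _ SC CW; rewrite -CW SC in nSW.
  by have [] := Yadj C W (XY _ CX) WY nCW.
have ltSn : (\dim S < n)%N.
  by rewrite hS kE (leq_trans (ltnW hkn)) ?leq_pred.
have dSW : (\dim (S + W) < n)%N.
  have [v vS v0] := exists_notin_coord_neq0 i0 ltSn.
  have CX := aboveS v vS v0; have [[dC _] SC] := CX.
  apply: (@leq_ltn_trans (\dim (S + <[v]> + W))); first by rewrite dimvS // addvS.
  (* The sum has dimension [2k - (k - 1) = k + 1], which is below [n] by [hkn]. *)
  have := dimv_sum_cap (S + <[v]>)%VS W.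
  rewrite dC dW capW // -{3}kE addnS -addSn => /addIn ->.
  by rewrite -ltn_predRL.
have [v vSW v0] := exists_notin_coord_neq0 i0 dSW.
have vS : v \notin S by apply: contra vSW; apply/subvP/addvSl.
have CX := aboveS v vS v0.
have capS : ((S + <[v]>) :&: W <= S)%VS.
  apply/subvP => w /memv_capP[/memv_addP[s sS [_ /vlineP[a ->] ->]] svW].
  (* Here [a *: v] is [w - s]; as [v] is outside [S + W], this forces [a = 0]. *)
  have : a *: v \in (S + W)%VS.
    by rewrite -(addKr s (a *: v)) memv_add ?rpredN.
  rewrite rpredZeq (negPf vSW) orbF => /eqP ->.
  by rewrite scale0r addr0.
case/negP: nSW; have <- : ((S + <[v]>) :&: W = S)%VS.
  by apply/eqP; rewrite eqEdim capS capW // hS leqnn.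
exact: capvSr.
Qed.
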